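(* Suppose $M_\delta:=\sup_{n\ge 1}\hat{\mathbb E}\big[|n^{-1/\alpha}S_n|^{\delta}\big]<\infty$. Let $h\in(0,1)$ and $\phi\in C_{b,Lip}(\mathbb R^d)$ with Lipschitz constant $C_\phi$, and let $u_h:[0,1]\times\mathbb R^d\to\mathbb R$ be defined recursively by $$u_h(t,x)=\phi(x)\ \text{ for }(t,x)\in[0,h)\times\mathbb R^d,\qquad u_h(t,x)=\hat{\mathbb E}\big[u_h(t-h,x+h^{1/\alpha}Z_1)\big]\ \text{ for }(t,x)\in[h,1]\times\mathbb R^d .$$ Then: (i) for any $t\in[0,1]$ and $x,y\in\mathbb R^d$, $|u_h(t,x)-u_h(t,y)|\le C_\phi|x-y|$; (ii) for any $t,s\in[0,1]$ and $x\in\mathbb R^d$, $$|u_h(t,x)-u_h(s,x)|\le C_\phi^{\delta}(2\|\phi\|_\infty)^{1-\delta}M_\delta\big(|t-s|^{\delta/\alpha}+h^{\delta/\alpha}\big).$$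
   Context: Sublinear expectation space. Let $\Omega$ be a set and $\mathcal H$ a linear space of real functions on $\Omega$ such that $\varphi(X_1,\dots,X_n)\in\mathcal H$ whenever $X_1,\dots,X_n\in\mathcal H$ and $\varphi\in C_{b,Lip}(\mathbb R^n)$ (bounded Lipschitz functions). A sublinear expectation is a map $\hat{\mathbb E}:\mathcal H\to\mathbb R$ that is monotone ($X\ge Y\Rightarrow\hat{\mathbb E}[X]\ge\hat{\mathbb E}[Y]$), preserves constants ($\hat{\mathbb E}[c]=c$), is sub-additive ($\hat{\mathbb E}[X+Y]\le\hat{\mathbb E}[X]+\hat{\mathbb E}[Y]$), and positively homogeneous ($\hat{\mathbb E}[\lambda X]=\lambda\hat{\mathbb E}[X]$ for $\lambda>0$). An $n$-dimensional random variable $X$ is a map $\Omega\to\mathbb R^n$ with $\varphi(X)\in\mathcal H$ for all $\varphi\in C_{b,Lip}(\mathbb R^n)$ ($X$ itself need not be in $\mathcal H$). $X$ and $X'$ are identically distributed if $\hat{\mathbb E}[\varphi(X)]=\hat{\mathbb E}[\varphi(X')]$ for all $\varphi\in C_{b,Lip}$. $Y$ is independent from $X$ if $\hat{\mathbb E}[\varphi(X,Y)]=\hat{\mathbb E}\big[\hat{\mathbb E}[\varphi(x,Y)]_{x=X}\big]$ for all $\varphi\in C_{b,Lip}$. Setting. $\alpha\in(0,2)$; $\{Z_i\}_{i\ge1}$ is an i.i.d. sequence of $\mathbb R^d$-valued random variables on $(\Omega,\mathcal H,\hat{\mathbb E})$, i.e. $Z_{i+1}$ is identically distributed with $Z_i$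 and independent from $(Z_1,\dots,Z_i)$ for each $i$. $S_n=\sum_{i=1}^nZ_i$. The exponent $\delta$ satisfies $0<\delta<\alpha$, and $\delta=1$ by convention when $\alpha\in(1,2)$ (so always $\delta\le 1$). The variables $|n^{-1/\alpha}S_n|^\delta$ are assumed to lie in the domain $\mathcal H$ of $\hat{\mathbb E}$. *)

(* Defs.v *)
From mathcomp Require Import all_boot all_order all_algebra.
From mathcomp Require Import all_classical all_reals all_analysis.

Set Implicit Arguments.
Unset Strict Implicit.
Unset Printing Implicit Defensive.

Import Order.TTheory GRing.Theory Num.Theory.
Local Open Scope classical_set_scope.
Local Open Scope ring_scope.

(* The canonical norm of 'rV[R]_n in MathComp-Analysis is the sup norm, hence
   this definition, and the Lipschitz condition stated with it. *)
Definition enorm (R : realType) (n : nat) (x : 'rV[R]_n) : R :=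
  Num.sqrt (\sum_(i < n) x ord0 i ^+ 2).

Definition lipschitz_with (R : realType) (n : nat) (C : R) (f : 'rV[R]_n -> R)
    : Prop :=
  0 <= C /\ forall x y, `|f x - f y| <= C * enorm (x - y).

(* C_{b,Lip}(R^n) *)
Definition CbLip (R : realType) (n : nat) (f : 'rV[R]_n -> R) : Prop :=
  (exists B : R, forall x, `|f x| <= B) /\ (exists C : R, lipschitz_with C f).

Definition supnorm (R : realType) (n : nat) (f : 'rV[R]_n -> R) : R :=
  sup (range (fun x => `|f x|)).

(* [Esp] is a total function of which only the restriction to the domain [Edom]
   is meaningful: nothing is assumed about its values outside [Edom]. *)
Record sublinear_expectation (R : realType) (Omega : Type) := {
  Edom : set (Omega -> R);
  Esp : (Omega -> R) -> R;
  Edom0 : Edom (fun _ => 0);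
  EdomD : forall X Y, Edom X -> Edom Y -> Edom (fun w => X w + Y w);
  EdomZ : forall (c : R) X, Edom X -> Edom (fun w => c * X w);
  Edom_comp : forall (n : nat) (X : 'I_n -> Omega -> R) (f : 'rV[R]_n -> R),
    (forall i, Edom (X i)) -> CbLip f ->
    Edom (fun w => f (\row_(i < n) X i w));
  Esp_mono : forall X Y, Edom X -> Edom Y -> (forall w, Y w <= X w) ->
    Esp Y <= Esp X;
  Esp_cst : forall c : R, Esp (fun _ => c) = c;
  Esp_subadd : forall X Y, Edom X -> Edom Y ->
    Esp (fun w => X w + Y w) <= Esp X + Esp Y;
  Esp_poshom : forall (l : R) X, 0 < l -> Edom X ->
    Esp (fun w => l * X w) = l * Esp X
}.

Definition random_vector (R : realType) (Omega : Type)
    (E : sublinear_expectation R Omega) (n : nat) (X : Omega -> 'rV[R]_n)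
    : Prop :=
  forall f : 'rV[R]_n -> R, CbLip f -> Edom E (fun w => f (X w)).

Definition identically_distributed (R : realType) (Omega : Type)
    (E : sublinear_expectation R Omega) (n : nat) (X X' : Omega -> 'rV[R]_n)
    : Prop :=
  forall f : 'rV[R]_n -> R, CbLip f ->
    Esp E (fun w => f (X w)) = Esp E (fun w => f (X' w)).

(* "Y is independent from X", a relation that is not symmetric.  The first
   clause says that the pair (X, Y) is a random vector, which does not follow
   from X and Y being so and without which E[f(X, Y)] is meaningless. *)
Definition independent_from (R : realType) (Omega : Type)
    (E : sublinear_expectation R Omega) (m n : nat)
    (Y : Omega -> 'rV[R]_n) (X : Omega -> 'rV[R]_m) : Prop :=
  random_vector E (fun w => row_mx (X w) (Y w)) /\
  forall f : 'rV[R]_(m + n) -> R, CbLip f ->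
    Esp E (fun w => f (row_mx (X w) (Y w))) =
    Esp E (fun w => Esp E (fun w' => f (row_mx (X w) (Y w')))).

(* Sequences are indexed from 0: [Z i] stands for Z_{i+1}. *)

(* (Z_1, ..., Z_k) as a single vector of R^(k d). *)
Definition prefix_vector (R : realType) (Omega : Type) (d : nat)
    (Z : nat -> Omega -> 'rV[R]_d) (k : nat) (w : Omega) : 'rV[R]_(k * d) :=
  mxvec (\matrix_(i < k, j < d) Z i w ord0 j).

Definition iid (R : realType) (Omega : Type)
    (E : sublinear_expectation R Omega) (d : nat)
    (Z : nat -> Omega -> 'rV[R]_d) : Prop :=
  [/\ forall i, random_vector E (Z i),
      forall i, identically_distributed E (Z i.+1) (Z i)
    & forall i, independent_from E (Z i.+1) (prefix_vector Z i.+1)].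

(* |n^{-1/alpha} S_n|^delta *)
Definition scaled_sum_pow (R : realType) (Omega : Type) (d : nat)
    (alpha delta : R) (Z : nat -> Omega -> 'rV[R]_d) (n : nat) (w : Omega) : R :=
  enorm ((n%:R `^ (- alpha^-1)) *: \sum_(i < n) Z i w) `^ delta.

Definition scaled_moments (R : realType) (Omega : Type)
    (E : sublinear_expectation R Omega) (d : nat) (alpha delta : R)
    (Z : nat -> Omega -> 'rV[R]_d) : set R :=
  [set Esp E (scaled_sum_pow alpha delta Z n) | n in [set n | (1 <= n)%N]].

(* [u] satisfies the recursion defining u_h.  As h > 0, the recursion
   determines [u] on [0, 1] x R^d; other values of [u] are unconstrained. *)
Definition recursive_scheme (R : realType) (Omega : Type)
    (E : sublinear_expectation R Omega) (d : nat) (alpha h : R)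
    (Z1 : Omega -> 'rV[R]_d) (phi : 'rV[R]_d -> R)
    (u : R -> 'rV[R]_d -> R) : Prop :=
  (forall (t : R) (x : 'rV[R]_d), 0 <= t < h -> u t x = phi x) /\
  (forall (t : R) (x : 'rV[R]_d), h <= t <= 1 ->
    u t x = Esp E (fun w => u (t - h) (x + (h `^ alpha^-1) *: Z1 w))).

(* Main.v *)
Require Import Defs.
From mathcomp Require Import all_boot all_order all_algebra.
From mathcomp Require Import all_classical all_reals all_analysis.
From mathcomp Require Import ring lra.

Set Implicit Arguments.
Unset Strict Implicit.

Import Order.TTheory GRing.Theory Num.Theory.
Local Open Scope classical_set_scope.
Local Open Scope ring_scope.

(** Let T f (x) = E[f (x + h^(1/alpha) Z_1)].  Unfolding the recursion,
    u_h(t, .) = T^k phi with k the integer part of t / h, and T preserves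
    Lipschitz constants and is nonexpansive for the sup norm; this gives (i)
    and reduces (ii) to the comparison of T^m phi with phi, where m is the
    difference of the integer parts, so that m h <= |t - s| + h.  By
    independence T^m phi (x) = E[phi (x + h^(1/alpha) S_m)].  Interpolating
    between the Lipschitz bound and the sup bound of phi, the difference with
    phi (x) is at most C^delta (2 |phi|)^(1-delta) E[|h^(1/alpha) S_m|^delta],
    and h^(1/alpha) S_m = (m h)^(1/alpha) (m^(-1/alpha) S_m).  The subadditivity
    of r |-> r^(delta/alpha) concludes. *)

(** * Powers with exponent in [0, 1] *)

Lemma powR_subadd (R : realType) (p a b : R) :
  0 <= p <= 1 -> 0 <= a -> 0 <= b -> (a + b) `^ p <= a `^ p + b `^ p.
Proof.
move=> /andP[p0 p1] a0 b0.
have := a0; rewrite le_eqVlt => /predU1P[<-|apos].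
  by rewrite add0r lerDr powR_ge0.
have s0 : 0 < a + b by rewrite ltr_wpDr.
(* For [c > 0], the ratio [c / (a + b)] lies in (0, 1], hence is at most its own power [p]. The
   instances [c = a] and [c = b] carry weights adding up to 1. *)
have frac c : 0 <= c -> c <= a + b -> c / (a + b) * (a + b) `^ p <= c `^ p.
  rewrite le_eqVlt => /predU1P[<-|c0] cs; first by rewrite mul0r mul0r powR_ge0.
  have q0 : 0 < c / (a + b) by rewrite divr_gt0.
  rewrite -[in leRHS](divfK (lt0r_neq0 s0) c) powRM ?(ltW q0) ?(ltW s0)//.
  rewrite ler_wpM2r ?powR_ge0// ger1_powR// q0 /=.
  by rewrite ler_pdivrMr// mul1r.
have -> : (a + b) `^ p = a / (a + b) * (a + b) `^ p + b / (a + b) * (a + b) `^ p.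
  by rewrite -mulrDl -mulrDl divff ?mul1r// lt0r_neq0.
by apply: lerD; apply: frac; rewrite ?lerDl ?lerDr.
Qed.

Lemma ler_powR_interp (R : realType) (p a b c : R) :
  0 <= p <= 1 -> 0 <= a -> a <= b -> a <= c -> a <= b `^ p * c `^ (1 - p).
Proof.
move=> /andP[p0 p1] a0 ab ac.
have := a0; rewrite le_eqVlt => /predU1P[<-|apos].
  by rewrite mulr_ge0 ?powR_ge0.
have -> : a = a `^ p * a `^ (1 - p).
  by rewrite -powRD ?subrKC ?powRr1// oner_eq0.
apply: ler_pM; rewrite ?powR_ge0//; apply: ge0_ler_powR => //;
  rewrite ?subr_ge0 ?nnegrE//; exact: le_trans ab || exact: le_trans ac.
Qed.

(** * The Euclidean norm and bounded Lipschitz functions *)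

Section EuclideanNorm.
Context {R : realType}.

Lemma enorm_ge0 n (x : 'rV[R]_n) : 0 <= enorm x.
Proof. exact: sqrtr_ge0. Qed.

Lemma enormZ n (a : R) (x : 'rV[R]_n) : enorm (a *: x) = `|a| * enorm x.
Proof.
rewrite /enorm -sqrtr_sqr -sqrtrM ?sqr_ge0// mulr_sumr.
by congr Num.sqrt; apply: eq_bigr => i _; rewrite mxE exprMn.
Qed.

Lemma ler_coord_enorm n (x : 'rV[R]_n) i : `|x ord0 i| <= enorm x.
Proof.
rewrite -sqrtr_sqr; apply: ler_wsqrtr.
by rewrite (bigD1 i)//= lerDl sumr_ge0// => j _; rewrite sqr_ge0.
Qed.

Lemma ler_enorm_sum n (x : 'rV[R]_n) : enorm x <= \sum_i `|x ord0 i|.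
Proof.
have s0 : 0 <= \sum_i `|x ord0 i| by rewrite sumr_ge0.
rewrite -[leRHS]ger0_norm// -sqrtr_sqr; apply: ler_wsqrtr.
rewrite [leRHS]expr2 mulr_suml; apply: ler_sum => i _.
rewrite -real_normK ?num_real// expr2 ler_wpM2l//.
by rewrite (bigD1 i)//= lerDl sumr_ge0.
Qed.

(** The sum of the absolute values of the entries is a crude operator norm; any finite bound will
    do, as it only serves to show that a composite is Lipschitz. *)
Lemma enorm_mulmx_bound m n (A : 'M[R]_(m, n)) :
  exists2 K : R, 0 <= K & forall x, enorm (x *m A) <= K * enorm x.
Proof.
exists (\sum_j \sum_i `|A i j|).
  by rewrite sumr_ge0// => j _; rewrite sumr_ge0.
move=> x; apply: le_trans (ler_enorm_sum _) _.
rewrite mulr_suml; apply: ler_sum => j _; rewrite mxE.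
apply: le_trans (ler_norm_sum _ _ _) _; rewrite mulr_suml.
apply: ler_sum => i _; rewrite normrM mulrC ler_wpM2l//.
exact: ler_coord_enorm.
Qed.

Lemma CbLip_cst n (c : R) : CbLip (fun _ : 'rV[R]_n => c).
Proof.
split; first by exists `|c|.
by exists 0; split=> // x y; rewrite subrr normr0 mul0r.
Qed.

(** A general matrix covers both the scaling of one vector and the map from a concatenated vector to
    a sum of its blocks. *)
Lemma CbLip_affine m n (f : 'rV[R]_n -> R) x (A : 'M[R]_(m, n)) :
  CbLip f -> CbLip (fun z => f (x + z *m A)).
Proof.
move=> [[B hB] [C [C0 hC]]]; split; first by exists B.
have [K K0 hK] := enorm_mulmx_bound A.
exists (C * K); split; first exact: mulr_ge0.
move=> y z; apply: le_trans (hC _ _) _.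
by rewrite opprD addrACA subrr add0r -mulmxBl -mulrA ler_wpM2l.
Qed.

Lemma CbLip_scale n (f : 'rV[R]_n -> R) x (a : R) :
  CbLip f -> CbLip (fun z => f (x + a *: z)).
Proof.
move=> hf; rewrite (_ : (fun z => _) = fun z => f (x + z *m a%:M)).
  exact: CbLip_affine.
by apply/funext => z; rewrite mul_mx_scalar.
Qed.

Lemma ler_dist_supnorm n (f : 'rV[R]_n -> R) x y :
  CbLip f -> `|f x - f y| <= 2 * supnorm f.
Proof.
move=> [[B hB] _].
have le_sup z : `|f z| <= supnorm f.
  by apply: ub_le_sup; [exists B => _ [z' _ <-] | exists z].
by apply: le_trans (ler_normB _ _) _; rewrite mulr2n mulrDl mul1r lerD.
Qed.

End EuclideanNorm.

(** * Sublinear expectations *)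

Section SublinearExpectation.
Context {R : realType} {Omega : Type} (E : sublinear_expectation R Omega).

Lemma Edom_cst (c : R) : Edom E (fun _ => c).
Proof.
(* A constant is a bounded Lipschitz function of an empty family of variables. *)
have noX : forall i : 'I_0, Edom E (fun=> 0 : R) by case.
exact: (Edom_comp noX (CbLip_cst 0 c)).
Qed.

Lemma Esp_scale (l : R) X :
  0 <= l -> Edom E X -> Esp E (fun w => l * X w) = l * Esp E X.
Proof.
rewrite le_eqVlt => /predU1P[<- _|]; last exact: Esp_poshom.
rewrite mul0r -[RHS](Esp_cst E); congr Esp.
by apply/funext => w; rewrite mul0r.
Qed.

(** Monotonicity and subadditivity applied to [X <= Y + V], then to [Y <= X + V], stand in for
    linearity. *)
Lemma Esp_dist X Y V : Edom E X -> Edom E Y -> Edom E V ->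
  (forall w, `|X w - Y w| <= V w) -> `|Esp E X - Esp E Y| <= Esp E V.
Proof.
have half X' Y' : Edom E X' -> Edom E Y' -> Edom E V ->
    (forall w, `|X' w - Y' w| <= V w) -> Esp E X' - Esp E Y' <= Esp E V.
  move=> dX dY dV le_V; rewrite lerBlDl.
  apply: le_trans (Esp_subadd dY dV).
  apply: Esp_mono => //; first exact: EdomD.
  by move=> w; rewrite -lerBlDl; apply: le_trans (ler_norm _) (le_V w).
move=> dX dY dV le_V; rewrite ler_norml half// andbT lerNl opprB half// => w.
by rewrite distrC.
Qed.

End SublinearExpectation.

(** * The one-step operator and its iterates *)

Definition transition {R : realType} {Omega : Type}
    (E : sublinear_expectation R Omega) {d : nat} (Y : Omega -> 'rV[R]_d)
    (a : R) (f : 'rV[R]_d -> R) (x : 'rV[R]_d) : R :=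
  Esp E (fun w => f (x + a *: Y w)).

Section Transition.
Context {R : realType} {Omega : Type} (E : sublinear_expectation R Omega).
Context {d : nat} (Y : Omega -> 'rV[R]_d) (a : R).
Context (hY : random_vector E Y).
Let T := transition E Y a.

Lemma transition_dom f x : CbLip f -> Edom E (fun w => f (x + a *: Y w)).
Proof. by move=> hf; apply: (hY (CbLip_scale x a hf)). Qed.

(** The shift [a *: Y w] cancels in the difference of the two arguments, so a constant dominates the
    integrand and [C] does not grow. *)
Lemma transition_lip C f : CbLip f -> lipschitz_with C f -> lipschitz_with C (T f).
Proof.
move=> hf [C0 hC]; split=> // x y.
rewrite -[leRHS](Esp_cst E).
apply: Esp_dist; [exact: transition_dom..|exact: Edom_cst|].
move=> w; apply: le_trans (hC _ _) _.
by rewrite opprD addrACA subrr addr0.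
Qed.

Lemma transition_CbLip f : CbLip f -> CbLip (T f).
Proof.
move=> hf; have [[B hB] [C hC]] := hf; split; last first.
  by exists C; apply: transition_lip.
exists B => x; rewrite -[T f x]subr0 -(Esp_cst E 0) -[B](Esp_cst E).
apply: Esp_dist; [exact: transition_dom|exact: Edom_cst..|].
by move=> w; rewrite subr0.
Qed.

Lemma iter_transition_CbLip k f : CbLip f -> CbLip (iter k T f).
Proof. by move=> hf; elim: k => //= k; apply: transition_CbLip. Qed.

Lemma iter_transition_lip k C f :
  CbLip f -> lipschitz_with C f -> lipschitz_with C (iter k T f).
Proof.
move=> hf hC; elim: k => //= k IH.
by apply: transition_lip => //; apply: iter_transition_CbLip.
Qed.

Lemma iter_transition_dist k f g (K : R) : CbLip f -> CbLip g ->
  (forall x, `|f x - g x| <= K) ->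
  forall x, `|iter k T f x - iter k T g x| <= K.
Proof.
move=> hf hg le_K; elim: k => //= k IH x; rewrite -[K](Esp_cst E).
apply: Esp_dist; [| |exact: Edom_cst|by []];
  apply: transition_dom; exact: iter_transition_CbLip.
Qed.

End Transition.

(** * Sums of i.i.d. vectors *)

Lemma prefix_sumS_mx (R : realType) (Omega : Type) (d k : nat)
    (Z : nat -> Omega -> 'rV[R]_d) (a : R) :
  exists B : 'M[R]_(k * d + d, d), forall w w',
    row_mx (prefix_vector Z k w) (Z k w') *m B =
    a *: (\sum_(i < k) Z i w + Z k w').
Proof.
(* The upper block adds up the [k] rows of the unflattened prefix, the lower one keeps the last
   vector. Being linear in the pair, the sum yields test functions to which independence applies. *)
exists (a *: col_mx (\sum_(i < k) lin1_mx (row i \o vec_mx)) 1%:M) => w w'.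
rewrite -scalemxAr mul_row_col mulmx1 mulmx_sumr; congr (_ *: (_ + _)).
apply: eq_bigr => i _; rewrite mul_rV_lin1 /= mxvecK.
by apply/rowP => j; rewrite !mxE.
Qed.

Section IidSums.
Context {R : realType} {Omega : Type} (E : sublinear_expectation R Omega).
Context {d : nat} (Z : nat -> Omega -> 'rV[R]_d) (a : R).
Context (hZ : iid E Z).
Let S k w := \sum_(i < k) Z i w.
Let T := transition E (Z 0%N) a.

Lemma iid_identically_distributed k : identically_distributed E (Z k) (Z 0%N).
Proof.
have [_ hid _] := hZ.
by elim: k => [|k IH] f hf //; rewrite hid// IH.
Qed.

Lemma iid_sum_dom k f x : CbLip f -> Edom E (fun w => f (x + a *: S k w)).
Proof.
(* Independence concerns nonempty prefixes only, so sums of zero or one term are treated apart. *)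
have [hrv _ hind] := hZ; move=> hf; case: k => [|[|k]].
- have -> : (fun w => f (x + a *: S 0 w)) = fun _ => f x.
    by apply/funext => w; rewrite /S big_ord0 scaler0 addr0.
  exact: Edom_cst.
- have -> : (fun w => f (x + a *: S 1 w)) = fun w => f (x + a *: Z 0%N w).
    by apply/funext => w; rewrite /S big_ord1.
  exact: transition_dom.
have [B hB] := prefix_sumS_mx k.+1 Z a; have [rv _] := hind k.
have -> : (fun w => f (x + a *: S k.+2 w)) =
    fun w => f (x + row_mx (prefix_vector Z k.+1 w) (Z k.+1 w) *m B).
  by apply/funext => w; rewrite hB /S big_ord_recr.
exact: (rv _ (CbLip_affine x B hf)).
Qed.

(** Independence freezes the first [k] terms and integrates the last one, which has the law of
    [Z 0]; the inner expectation is then [T f]. *)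
Lemma Esp_iid_sumS k f x : CbLip f ->
  Esp E (fun w => f (x + a *: S k.+1 w)) = Esp E (fun w => T f (x + a *: S k w)).
Proof.
have [_ _ hind] := hZ; move=> hf; case: k => [|k].
  have -> : (fun w => T f (x + a *: S 0 w)) = fun _ => T f x.
    by apply/funext => w; rewrite /S big_ord0 scaler0 addr0.
  by rewrite Esp_cst; congr Esp; apply/funext => w; rewrite /S big_ord1.
have [B hB] := prefix_sumS_mx k.+1 Z a; have [_ ind] := hind k.
transitivity (Esp E (fun w =>
    f (x + row_mx (prefix_vector Z k.+1 w) (Z k.+1 w) *m B))).
  by congr Esp; apply/funext => w; rewrite hB /S big_ord_recr.
rewrite (ind _ (CbLip_affine x B hf)); congr Esp; apply/funext => w.
rewrite /T /transition.
rewrite -(iid_identically_distributed k.+1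
  (CbLip_scale (x + a *: S k.+1 w) a hf)).
by congr Esp; apply/funext => w'; rewrite hB scalerDr addrA.
Qed.

Lemma iter_transitionE k f x : CbLip f ->
  iter k T f x = Esp E (fun w => f (x + a *: S k w)).
Proof.
have [hrv _ _] := hZ.
elim: k f => [|k IH] f hf /=.
  rewrite -[LHS](Esp_cst E); congr Esp; apply/funext => w.
  by rewrite /S big_ord0 scaler0 addr0.
(* The innermost [T] is peeled off, so the induction hypothesis is used at [T f] rather than at
   [f]. *)
rewrite -iterS iterSr IH; last exact: transition_CbLip.
by rewrite Esp_iid_sumS.
Qed.

End IidSums.

(** * The scheme as an iterate, and its regularity *)

Lemma recursive_schemeE (R : realType) (Omega : Type)
    (E : sublinear_expectation R Omega) (d : nat) (alpha h : R)
    (Z1 : Omega -> 'rV[R]_d) (phi : 'rV[R]_d -> R) (u : R -> 'rV[R]_d -> R)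
    (k : nat) (t : R) :
  0 < h -> recursive_scheme E alpha h Z1 phi u -> t <= 1 ->
  k%:R * h <= t < k.+1%:R * h ->
  u t = iter k (transition E Z1 (h `^ alpha^-1)) phi.
Proof.
(* The time [t] stays general: one step of the scheme turns [(k.+1, t)] into [(k, t - h)]. Equality
   of functions allows rewriting under [Esp]. *)
move=> h0 [u0 uS]; elim: k t => [|k IH] t t1 /andP[kt tk]; apply/funext => x.
  by rewrite u0// -[h]mul1r tk andbT; rewrite mul0r in kt.
move: (kt) (tk); rewrite -!natr1 !mulrDl !mul1r => kt' tk'.
have kh0 : 0 <= k%:R * h by rewrite mulr_ge0// ltW.
rewrite uS ?t1 ?andbT; last by lra.
rewrite (IH (t - h))//; first by lra.
by rewrite -natr1 mulrDl mul1r; apply/andP; split; lra.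
Qed.

Lemma iter_transition_moment (R : realType) (Omega : Type)
    (E : sublinear_expectation R Omega) (d : nat) (alpha delta h C : R)
    (Z : nat -> Omega -> 'rV[R]_d) (phi : 'rV[R]_d -> R) (m : nat)
    (x : 'rV[R]_d) :
  0 < delta <= 1 -> 0 < h -> (1 <= m)%N -> iid E Z ->
  Edom E (scaled_sum_pow alpha delta Z m) ->
  CbLip phi -> lipschitz_with C phi ->
  `|iter m (transition E (Z 0%N) (h `^ alpha^-1)) phi x - phi x| <=
    C `^ delta * (2 * supnorm phi) `^ (1 - delta) *
    ((m%:R * h) `^ (delta / alpha) * Esp E (scaled_sum_pow alpha delta Z m)).
Proof.
move=> /andP[d0 d1] h0 m1 hZ dom hphi [C0 hC].
have m0 : 0 < m%:R :> R by rewrite ltr0n.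
rewrite (iter_transitionE _ hZ _ x hphi) -[phi x in leLHS](Esp_cst E) [leRHS]mulrA.
set K := (X in _ <= X * _); have K0 : 0 <= K by rewrite !mulr_ge0 ?powR_ge0.
rewrite -Esp_scale//; apply: Esp_dist; [|exact: Edom_cst|exact: EdomZ|].
  exact: (iid_sum_dom (h `^ alpha^-1) hZ m x hphi).
move=> w; set s := \sum_(i < m) Z i w.
have lip : `|phi (x + h `^ alpha^-1 *: s) - phi x| <= C * (h `^ alpha^-1 * enorm s).
  by apply: le_trans (hC _ _) _; rewrite addrAC subrr add0r enormZ ger0_norm ?powR_ge0.
apply: le_trans (@ler_powR_interp _ delta _ _ _ _ _ lip
  (ler_dist_supnorm _ _ hphi)) _ => //; first by rewrite ltW.
(* Both sides agree: the factor [m ^ (delta / alpha)] cancels against the normalization of the sum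
   raised to the power [delta]. *)
rewrite le_eqVlt; apply/orP; left; apply/eqP.
rewrite /scaled_sum_pow /K -/s enormZ ger0_norm ?powR_ge0//.
set P := (2 * _) `^ _.
rewrite !powRM ?mulr_ge0 ?powR_ge0 ?enorm_ge0 ?(ltW h0)//.
rewrite -!powRrM mulNr (mulrC alpha^-1) powRN.
have := lt0r_neq0 (powR_gt0 (delta / alpha) m0).
set M := m%:R `^ _ => M0.
by field.
Qed.

Theorem theorem3p1 (R : realType) (Omega : Type)
    (E : sublinear_expectation R Omega) (d : nat)
    (alpha delta : R) (Z : nat -> Omega -> 'rV[R]_d)
    (h C : R) (phi : 'rV[R]_d -> R) (u : R -> 'rV[R]_d -> R)
    (halpha : 0 < alpha < 2)
    (hdelta : 0 < delta < alpha)
    (hdelta1 : 1 < alpha -> delta = 1)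
    (hZ : iid E Z)
    (hdom : forall n, (1 <= n)%N -> Edom E (scaled_sum_pow alpha delta Z n))
    (hM : has_ubound (scaled_moments E alpha delta Z))
    (hh : 0 < h < 1)
    (hphi : CbLip phi)
    (hC : lipschitz_with C phi)
    (hu : recursive_scheme E alpha h (Z 0%N) phi u) :
  (forall (t : R) (x y : 'rV[R]_d), 0 <= t <= 1 ->
     `|u t x - u t y| <= C * enorm (x - y)) /\
  (forall (t s : R) (x : 'rV[R]_d), 0 <= t <= 1 -> 0 <= s <= 1 ->
     `|u t x - u s x| <=
       C `^ delta * (2 * supnorm phi) `^ (1 - delta) *
       sup (scaled_moments E alpha delta Z) *
       (`|t - s| `^ (delta / alpha) + h `^ (delta / alpha))).
Proof.
have /andP[a0 _] := halpha; have /andP[d0 da] := hdelta; have /andP[h0 _] := hh.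
have d1 : delta <= 1.
  by have [a1|/hdelta1 ->//] := leP alpha 1; exact: le_trans (ltW da) a1.
have p01 : 0 <= delta / alpha <= 1.
  by rewrite divr_ge0 ?(ltW d0) ?(ltW a0)//= ler_pdivrMr// mul1r ltW.
have [hrv _ _] := hZ; have hZ0 := hrv 0%N.
set T := transition E (Z 0%N) (h `^ alpha^-1).
have uE t : 0 <= t <= 1 ->
    exists2 k, k%:R * h <= t < k.+1%:R * h & u t = iter k T phi.
  move=> /andP[t0 t1].
  have /truncn_itv : 0 <= t / h by rewrite divr_ge0// ltW.
  rewrite ler_pdivlMr// ltr_pdivrMr// => kt.
  by exists (Num.truncn (t / h)) => //; apply: recursive_schemeE kt.
split=> [t x y /uE[k _ ->]|].
  by have [_] := iter_transition_lip (h `^ alpha^-1) hZ0 k hphi hC; apply.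
set M := sup _.
have leM n : (1 <= n)%N -> Esp E (scaled_sum_pow alpha delta Z n) <= M.
  by move=> n1; apply: ub_le_sup => //; exists n.
have M0 : 0 <= M.
  apply: le_trans (leM 1%N isT); rewrite -[leLHS](Esp_cst E).
  apply: Esp_mono; [exact: hdom|exact: Edom_cst|].
  by move=> w; exact: powR_ge0.
suff ordered t s x : 0 <= t <= 1 -> 0 <= s <= 1 -> s <= t ->
     `|u t x - u s x| <=
       C `^ delta * (2 * supnorm phi) `^ (1 - delta) * M *
       (`|t - s| `^ (delta / alpha) + h `^ (delta / alpha)).
  move=> t s x ht hs; have [st|/ltW ts] := leP s t; first exact: ordered.
  by rewrite distrC (distrC t); exact: ordered.
move=> ht hs st.
have [k /andP[kt tk] ->] := uE _ ht; have [l /andP[ls sl] ->] := uE _ hs.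
have lk : (l <= k)%N.
  by rewrite -ltnS -(ltr_nat R) -(ltr_pM2r h0); lra.
(* The [l] outer iterations are common to both terms and are removed by nonexpansiveness. *)
rewrite -(subnKC lk) iterD; set m := (k - l)%N.
apply: iter_transition_dist => //; first exact: iter_transition_CbLip.
move=> y; have K0 : 0 <= C `^ delta * (2 * supnorm phi) `^ (1 - delta).
  by rewrite mulr_ge0 ?powR_ge0.
(* The moments are bounded for at least one summand; for [m = 0] the difference vanishes. *)
have [->|m1] := posnP m.
  by rewrite subrr normr0 !mulr_ge0 ?addr_ge0 ?powR_ge0.
apply: le_trans (iter_transition_moment y _ h0 m1 hZ (hdom _ m1) hphi hC) _; first by rewrite d0.
rewrite -[leRHS]mulrA ler_wpM2l// [leLHS]mulrC; apply: ler_pM; rewrite ?powR_ge0//.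
- rewrite -[leLHS](Esp_cst E); apply: Esp_mono; [exact: hdom|exact: Edom_cst|].
  by move=> w; exact: powR_ge0.
- exact: leM.
apply: le_trans (powR_subadd p01 (normr_ge0 _) (ltW h0)).
have mh0 : 0 <= m%:R * h by rewrite mulr_ge0// ltW.
(* From [k h <= t] and [s < (l + 1) h]; rounding [s] down to the grid costs the extra [h]. *)
have mle : m%:R * h <= `|t - s| + h.
  rewrite /m natrB// mulrBl ger0_norm ?subr_ge0//.
  by move: sl; rewrite -natr1 mulrDl mul1r; lra.
apply: ge0_ler_powR; rewrite ?nnegrE ?addr_ge0 ?(ltW h0)//.
by have /andP[] := p01.
Qed.
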